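(* For all integers $n\ge0$, $\alpha\ge0$ and $\beta\ge1$: \begin{align*} &\overline{S_3}(3n)\equiv\overline{S_3}(n)\pmod 4,\\ &\overline{S_3}\big(2^\alpha(3n+j)\big)\equiv\overline{S_3}(3n+j)\pmod 4\quad\text{for each } j\in\{0,1,2\},\\ &\overline{S_3}\big(2^{2\beta+j}(3n+2)\big)\equiv\overline{S_3}\big(2^j(3n+2)\big)\pmod 8\quad\text{for } j\in\{0,1\}. \end{align*}
   Context: For $|q|<1$ and a positive integer $k$, write $f_k=\prod_{j\ge1}(1-q^{kj})$. The function $\overline{S_3}(n)$ (number of $3$-Schur overpartitions of $n$) is defined by $\sum_{n\ge0}\overline{S_3}(n)q^n=\prod_{n\ge1}\frac{(1+q^{2n-1})(1-q^{3(2n-1)})}{(1+q^{3(2n-1)})(1-q^{2n-1})}=\frac{f_2^3f_3^2f_{12}}{f_1^2f_4f_6^3}$. *)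

(* Defs.v *)
From HB Require Import structures.
From mathcomp Require Import all_boot all_order all_algebra.
From mathcomp Require Import boolp.

Set Implicit Arguments.
Unset Strict Implicit.
Unset Printing Implicit Defensive.

Import Order.TTheory GRing.Theory Num.Theory.
Local Open Scope ring_scope.

(* The ring Z[[q]] of formal power series with integer coefficients;          *)
(* (f n) is the coefficient of q^n in f.                                      *)
Record fps := Fps { coefs :> nat -> int }.

Lemma fpsP (f g : fps) : (forall n, f n = g n) <-> f = g.
Proof.
split=> [|-> //]; case: f g => [f] [g] /= fg; congr Fps; exact: funext.
Qed.

HB.instance Definition _ := gen_eqMixin fps.
HB.instance Definition _ := gen_choiceMixin fps.

Definition fps_const (c : int) : fps := Fps (fun n => if n == 0%N then c else 0).
Definition fps_opp (f : fps) : fps := Fps (fun n => - f n).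
Definition fps_add (f g : fps) : fps := Fps (fun n => f n + g n).
Definition fps_mul (f g : fps) : fps :=
  Fps (fun n => \sum_(i < n.+1) f i * g (n - i)%N).

Fact fps_addA : associative fps_add.
Proof. by move=> f g h; apply/fpsP => n /=; rewrite addrA. Qed.
Fact fps_addC : commutative fps_add.
Proof. by move=> f g; apply/fpsP => n /=; rewrite addrC. Qed.
Fact fps_add0 : left_id (fps_const 0) fps_add.
Proof. by move=> f; apply/fpsP => n /=; rewrite if_same add0r. Qed.
Fact fps_addN : left_inverse (fps_const 0) fps_opp fps_add.
Proof. by move=> f; apply/fpsP => n /=; rewrite addNr if_same. Qed.

HB.instance Definition _ :=
  GRing.isZmodule.Build fps fps_addA fps_addC fps_add0 fps_addN.

(* Truncation modulo q^N, used to transfer ring identities from {poly int}.   *)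
Definition fps_trunc (N : nat) (f : fps) : {poly int} := \poly_(i < N) f i.

Lemma coef_trunc N f n : (n < N)%N -> (fps_trunc N f)`_n = f n.
Proof. by move=> ltnN; rewrite coef_poly ltnN. Qed.

Lemma coef_trunc_mul N (p r : {poly int}) (f g : fps) n : (n < N)%N ->
  (forall i, (i < N)%N -> p`_i = f i) -> (forall i, (i < N)%N -> r`_i = g i) ->
  (p * r)`_n = fps_mul f g n.
Proof.
move=> ltnN pf rg; rewrite coefM; apply: eq_bigr => i _.
have lei : (i <= n)%N by rewrite -ltnS.
by rewrite pf ?rg // (leq_ltn_trans _ ltnN) // leq_subr.
Qed.

Fact fps_mulA : associative fps_mul.
Proof.
move=> f g h; apply/fpsP => n.
pose p := fps_trunc n.+1.
have E u i : (i < n.+1)%N -> (p u)`_i = u i by exact: coef_trunc.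
have M u v i : (i < n.+1)%N -> (p u * p v)`_i = fps_mul u v i.
  by move=> lti; apply: (coef_trunc_mul lti); apply: E.
have -> : fps_mul f (fps_mul g h) n = (p f * (p g * p h))`_n.
  by rewrite (@coef_trunc_mul n.+1 _ _ f (fps_mul g h)) // => i;
    [apply: E | apply: M].
have -> : fps_mul (fps_mul f g) h n = (p f * p g * p h)`_n.
  by rewrite (@coef_trunc_mul n.+1 _ _ (fps_mul f g) h) // => i;
    [apply: M | apply: E].
by rewrite mulrA.
Qed.

Fact fps_mulC : commutative fps_mul.
Proof.
move=> f g; apply/fpsP => n; pose p := fps_trunc n.+1.
have E u i : (i < n.+1)%N -> (p u)`_i = u i by exact: coef_trunc.
have M u v : fps_mul u v n = (p u * p v)`_n.
  by rewrite (@coef_trunc_mul n.+1 _ _ u v) //; apply: E.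
by rewrite !M mulrC.
Qed.

Fact fps_mul1 : left_id (fps_const 1) fps_mul.
Proof.
move=> f; apply/fpsP => n /=; rewrite big_ord_recl /= mul1r subn0 big1 ?addr0 //.
by move=> i _; rewrite mul0r.
Qed.

Fact fps_mulDl : left_distributive fps_mul fps_add.
Proof.
move=> f g h; apply/fpsP => n /=; rewrite -big_split /=.
by apply: eq_bigr => i _; rewrite mulrDl.
Qed.

Fact fps_1neq0 : fps_const 1 != 0 :> fps.
Proof. by apply/eqP => /fpsP /(_ 0%N). Qed.

HB.instance Definition _ := GRing.Zmodule_isComNzRing.Build fps
  fps_mulA fps_mulC fps_mul1 fps_mulDl fps_1neq0.

Lemma fpsD (f g : fps) n : (f + g) n = f n + g n. Proof. by []. Qed.
Lemma fpsN (f : fps) n : (- f) n = - f n. Proof. by []. Qed.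
Lemma fps0 n : (0 : fps) n = 0. Proof. by rewrite /= if_same. Qed.
Lemma fps1 n : (1 : fps) n = (n == 0%N)%:R. Proof. by case: n. Qed.
Lemma fpsM (f g : fps) n : (f * g) n = \sum_(i < n.+1) f i * g (n - i)%N.
Proof. by []. Qed.
Lemma fpsM0 (f g : fps) : (f * g) 0%N = f 0%N * g 0%N.
Proof. by rewrite fpsM big_ord_recl big_ord0 addr0. Qed.
Lemma fps_sum (I : Type) (r : seq I) (P : pred I) (F : I -> fps) n :
  (\sum_(i <- r | P i) F i) n = \sum_(i <- r | P i) F i n.
Proof.
by elim/big_rec2: _ => [|i x y _ <-]; rewrite ?fps0.
Qed.

(* f is invertible iff f 0 is a unit c of Z (i.e. 1 or -1), and then          *)
(* 1 / f = c^-1 (1 + u + u^2 + ...) with u = 1 - c^-1 f, where u^k has no      *)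
(* terms of degree < k.                                                       *)
Definition fps_unit : {pred fps} := fun f => f 0%N \is a GRing.unit.
Definition fps_inv (f : fps) : fps :=
  if fps_unit f then
    let c := fps_const (f 0%N)^-1 in
    Fps (fun n => (c * \sum_(k < n.+1) (1 - c * f) ^+ k) n)
  else f.

Lemma fps_expr_lt (u : fps) k n : u 0%N = 0 -> (n < k)%N -> (u ^+ k) n = 0.
Proof.
move=> u0; elim: k n => // k IHk n ltnk.
rewrite exprS fpsM big_ord_recl u0 mul0r add0r big1 // => i _.
rewrite IHk ?mulr0 // lift0.
have n_gt0 : (0 < n)%N := leq_ltn_trans (leq0n i) (ltn_ord i).
by rewrite (@leq_trans n) ?ltn_subrL ?n_gt0.
Qed.

Fact fps_mulV : {in fps_unit, left_inverse 1 fps_inv *%R}.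
Proof.
move=> f Uf; have Uf0 : fps_unit f := Uf.
rewrite /fps_inv Uf0; set c := fps_const _; set u := 1 - c * f.
have u0 : u 0%N = 0.
  by rewrite /u fpsD fpsN fpsM0 /= mulVr ?subrr //; exact: Uf0.
apply/fpsP => n.
have trunc m : (m <= n)%N ->
    (c * \sum_(k < m.+1) u ^+ k) m = (c * \sum_(k < n.+1) u ^+ k) m.
  move=> lemn; rewrite !fpsM; apply: eq_bigr => i _; congr (_ * _).
  rewrite !fps_sum (big_ord_widen n.+1 (fun k => (u ^+ k) (m - i)%N)) ?ltnS //.
  rewrite [RHS](bigID (fun k : 'I__ => (k < m.+1)%N)) /= [X in _ + X]big1 ?addr0 //.
  move=> k; rewrite -leqNgt => ltmk.
  by rewrite fps_expr_lt // (leq_ltn_trans (leq_subr _ _)).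
transitivity ((c * (\sum_(k < n.+1) u ^+ k) * f) n).
  rewrite !fpsM; apply: eq_bigr => i _; congr (_ * _).
  by rewrite -trunc // -ltnS.
rewrite mulrAC -[c * f](subKr 1) -/u -opprB mulNr -subrX1 opprB fpsD fpsN.
by rewrite (fps_expr_lt u0) // subr0.
Qed.

Fact fps_unitPl (f g : fps) : g * f = 1 -> fps_unit f.
Proof.
move=> gf; have gf0 : g 0%N * f 0%N = 1 by rewrite -fpsM0 gf.
by rewrite /fps_unit; apply/unitrP; exists (g 0%N); split=> //; rewrite mulrC.
Qed.

Fact fps_inv_out : {in [predC fps_unit], fps_inv =1 id}.
Proof. by move=> f /negbTE Uf; rewrite /fps_inv [fps_unit f]Uf. Qed.

HB.instance Definition _ := GRing.ComNzRing_hasMulInverse.Build fps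
  fps_mulV fps_unitPl fps_inv_out.

Definition fps_q : fps := Fps (fun n => (n == 1%N)%:R).

Lemma fps_qXn m n : (fps_q ^+ m) n = (n == m)%:R.
Proof.
elim: m n => [|m IHm] n; first by rewrite expr0 fps1.
rewrite exprS fpsM; case: n => [|n]; first by rewrite big_ord_recl big_ord0 mul0r.
rewrite big_ord_recl mul0r add0r big_ord_recl /= mul1r subSS subn0 IHm eqSS.
by rewrite big1 ?addr0 // => i _; rewrite mul0r.
Qed.

(* Coefficientwise convergence, i.e. convergence in the q-adic topology.      *)
Definition fps_cvg (u : nat -> fps) (l : fps) : Prop :=
  forall n, exists N, forall m, (N <= m)%N -> u m n = l n.

(* The infinite product of the F k for k >= 1. It is only meaningful when     *)
(* F k = 1 mod q^k for all k, so that the coefficient of q^n is already that  *)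
(* of the product of the first n factors; see fps_infprodP.                   *)
Definition fps_infprod (F : nat -> fps) : fps :=
  Fps (fun n => (\prod_(1 <= k < n.+1) F k) n).

Definition fps_eq1mod (N : nat) (f : fps) : Prop :=
  forall i, (i < N)%N -> f i = (1 : fps) i.

Lemma fps_eq1mod_mulr N (f g : fps) n :
  fps_eq1mod N g -> (n < N)%N -> (f * g) n = f n.
Proof.
move=> g1 ltnN; rewrite -[in RHS](mulr1 f) !fpsM; apply: eq_bigr => i _.
by rewrite g1 // (leq_ltn_trans (leq_subr _ _)).
Qed.

Lemma fps_infprodP (F : nat -> fps) : (forall k, fps_eq1mod k (F k)) ->
  fps_cvg (fun N => \prod_(1 <= k < N.+1) F k) (fps_infprod F).
Proof.
move=> F1 n; exists n => m /subnK <-; elim: (m - n)%N => //= d IHd.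
rewrite addSn big_nat_recr // (@fps_eq1mod_mulr (d + n).+1) //.
by rewrite ltnS leq_addl.
Qed.

Definition S3_factor (k : nat) : fps :=
  ((1 + fps_q ^+ (2 * k - 1)) * (1 - fps_q ^+ (3 * (2 * k - 1)))) /
  ((1 + fps_q ^+ (3 * (2 * k - 1))) * (1 - fps_q ^+ (2 * k - 1))).

(* Number of 3-Schur overpartitions of n, defined by its generating function. *)
Definition S3bar (n : nat) : int := fps_infprod S3_factor n.

Lemma fps_eq1modM N f g :
  fps_eq1mod N f -> fps_eq1mod N g -> fps_eq1mod N (f * g).
Proof. by move=> f1 g1 i ltiN; rewrite (fps_eq1mod_mulr _ g1) ?f1. Qed.

Lemma fps_eq1modV N f : f \is a GRing.unit ->
  fps_eq1mod N f -> fps_eq1mod N f^-1.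
Proof. by move=> Uf f1 i ltiN; rewrite -(mulVr Uf) (fps_eq1mod_mulr _ f1). Qed.

Lemma fps_eq1modDq N m : (N <= m)%N -> fps_eq1mod N (1 + fps_q ^+ m).
Proof.
move=> leNm i ltiN; rewrite fpsD fps_qXn (ltn_eqF (leq_trans ltiN leNm)).
by rewrite addr0.
Qed.

Lemma fps_eq1modBq N m : (N <= m)%N -> fps_eq1mod N (1 - fps_q ^+ m).
Proof.
move=> leNm i ltiN; rewrite fpsD fpsN fps_qXn (ltn_eqF (leq_trans ltiN leNm)).
by rewrite subr0.
Qed.

Lemma S3_denom_unit k : (0 < k)%N ->
  (1 + fps_q ^+ (3 * (2 * k - 1))) * (1 - fps_q ^+ (2 * k - 1))
    \is a GRing.unit.
Proof.
case: k => // k _; rewrite unitrM; apply/andP.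
by split; rewrite /in_mem /= /fps_unit fpsD ?fpsN fps_qXn mulnS.
Qed.

Lemma S3_factor_eq1mod k : fps_eq1mod k (S3_factor k).
Proof.
case: k => [|k]; first by [].
have le1 : (k.+1 <= 2 * k.+1 - 1)%N.
  by rewrite mul2n -addnn addSn subn1 /= leq_addl.
have le3 : (k.+1 <= 3 * (2 * k.+1 - 1))%N by rewrite (leq_trans le1) ?leq_pmull.
apply: fps_eq1modM; last apply: fps_eq1modV; first last.
- by apply: fps_eq1modM; [apply: fps_eq1modDq | apply: fps_eq1modBq].
- exact: S3_denom_unit.
- by apply: fps_eq1modM; [apply: fps_eq1modDq | apply: fps_eq1modBq].
Qed.

Lemma S3bar_cvg :
  fps_cvg (fun N => \prod_(1 <= k < N.+1) S3_factor k) (Fps S3bar).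
Proof. exact: (fps_infprodP S3_factor_eq1mod). Qed.

(* Main.v *)
(* With phi(q) = sum of q^(n^2) over all integers n, Gauss's identity
   prod (1 - x^k) / (1 + x^k) = phi(-x), taken at x = -q, q^2, -q^3, q^6, gives
   the generating function phi(q) phi(-q^6) / (phi(-q^2) phi(q^3)).
   Each phi is 1 + 2 theta, so expanding modulo 8 leaves, for n prime to 3,
   indicators of n = a x^2 and numbers of representations n = a x^2 + b y^2 with
   x, y > 0. Modulo 4 only the forms x^2, 2x^2, 3x^2, 6x^2 occur, and they are
   permuted by n -> 2n and n -> 3n. Modulo 8, the substitution
   (x, y) -> (2x, 2y) matches all terms at 4n with those at n, up to the
   solutions of 2n = x^2 + 3y^2 with x, y odd and the sign (-1)^k in the
   coefficient of q^(2k^2). These two defects cancel, because multiplication by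
   a cube root of unity is an involution on those solutions, whose only fixed
   points are x = y. *)

Require Import Defs.
From mathcomp Require Import all_boot all_order all_algebra.
From mathcomp Require Import zify ring.

Set Implicit Arguments.
Unset Strict Implicit.
Unset Printing Implicit Defensive.

Import Order.TTheory GRing.Theory Num.Theory.
Local Open Scope ring_scope.

(** * The identity of Gauss *)

Section Gauss.

Variables (R : comUnitRingType) (x : R).

Definition gauss_prod (k n : nat) : R :=
  \prod_(k.+1 <= i < n.+1) ((1 - x ^+ i) / (1 + x ^+ i)).

(** [1 + 2 * theta_part n] is a partial sum of phi(-x). *)
Definition theta_part (n : nat) : R :=
  \sum_(1 <= s < n.+1) (-1) ^+ s * x ^+ (s ^ 2).

Hypothesis Ux : forall k, (0 < k)%N -> 1 + x ^+ k \is a GRing.unit.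

Lemma gauss_prodnn n : gauss_prod n n = 1.
Proof. by rewrite /gauss_prod big_geq. Qed.

Lemma gauss_prod_recr k n : (k <= n)%N ->
  gauss_prod k n.+1 = gauss_prod k n * ((1 - x ^+ n.+1) / (1 + x ^+ n.+1)).
Proof. by move=> lekn; rewrite /gauss_prod big_nat_recr. Qed.

Lemma gauss_prod_recl k n : (k < n)%N ->
  gauss_prod k n = (1 - x ^+ k.+1) / (1 + x ^+ k.+1) * gauss_prod k.+1 n.
Proof. by move=> ltkn; rewrite /gauss_prod big_ltn. Qed.

(* Shanks' finite form of Gauss's identity; it is proved by telescoping in k. *)
Lemma shanks_identity n :
  1 + 2 * theta_part n = gauss_prod 0 n
    + \sum_(1 <= k < n.+1)
        (-1) ^+ k * gauss_prod k n * (2 * x ^+ (k * n.+1)) / (1 + x ^+ k).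
Proof.
elim: n => [|n IHn].
  by rewrite /theta_part !big_geq // gauss_prodnn mulr0.
rewrite /theta_part big_nat_recr //= mulrDr addrA IHn.
rewrite [in RHS]big_nat_recr //= gauss_prod_recr // gauss_prodnn.
set m := n.+1; set r := (1 + x ^+ m)^-1.
have rE : r * (1 + x ^+ m) = 1 by rewrite mulVr // Ux.
(* Passing from [n] to [m] changes the k-th summand by 2r(v(k+1) - v(k)). The end v(1) turns the
   product up to [n] into the one up to [m]; v(m) and the new summand k = m add up to the new square
   term. *)
pose v k := (-1) ^+ k * gauss_prod k.-1 n * x ^+ (k * m).
have -> : \sum_(1 <= k < m)
      (-1) ^+ k * gauss_prod k m * (2 * x ^+ (k * m.+1)) / (1 + x ^+ k)
    = \sum_(1 <= k < m)
      (-1) ^+ k * gauss_prod k n * (2 * x ^+ (k * m)) / (1 + x ^+ k)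
      + 2 * r * (v m - v 1%N).
  rewrite -telescope_sumr // mulr_sumr -big_split /=.
  apply: eq_big_nat => k /andP[k_gt0 ltkm].
  rewrite /v /= gauss_prod_recr // -/m -/r.
  case: k k_gt0 ltkm => // k _ ltkm /=.
  rewrite (@gauss_prod_recl k) //.
  set s := (1 + x ^+ k.+1)^-1.
  have sE : s * (1 + x ^+ k.+1) = 1 by rewrite mulVr // Ux.
  rewrite mulnS exprD [(k.+2 * m)%N]mulSn exprD [_ ^+ k.+2]exprS.
  set e := (-1) ^+ k.+1; set p := gauss_prod _ _.
  set y := x ^+ (_ * _); set z := x ^+ k.+1 in sE *; set w := x ^+ m in rE *.
  apply/eqP; rewrite -subr_eq0; apply/eqP.
  transitivity (2 * e * p * y *
      (s * (r * (1 + w) - 1) - r * w * (s * (1 + z) - 1))); first by ring.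
  by rewrite rE sE !subrr !mulr0 subrr mulr0.
rewrite /v /= gauss_prodnn mul1n expnS expn1 !expr1 mulr1.
rewrite [(m * m.+1)%N]mulnS exprD.
set e := (-1) ^+ m; set p := gauss_prod _ _; set S := \sum_(_ <= _ < _) _.
set y := x ^+ (_ * _); set w := x ^+ m in rE *.
apply/eqP; rewrite -subr_eq0; apply/eqP.
transitivity ((1 - r * (1 + w)) * (2 * e * y + p)); first by ring.
by rewrite rE subrr mul0r.
Qed.

(** Each summand in Shanks' formula contains x^(k(n+1)) with k >= 1, so x^(n+1) can be factored
    out. *)
Lemma gauss_identity n : exists e,
  gauss_prod 0 n = 1 + 2 * theta_part n + x ^+ n.+1 * e.
Proof.
exists (- \sum_(1 <= k < n.+1)
   (-1) ^+ k * gauss_prod k n * (2 * x ^+ (k.-1 * n.+1)) / (1 + x ^+ k)).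
rewrite shanks_identity mulrN mulr_sumr -addrA -sumrB big_nat big1 ?addr0 //.
by case=> // k _; rewrite mulSn exprD; ring.
Qed.

Lemma theta_part_trunc m n : (n <= m)%N ->
  exists e, theta_part m = theta_part n + x ^+ n.+1 * e.
Proof.
move=> lenm; exists (\sum_(n.+1 <= s < m.+1) (-1) ^+ s * x ^+ (s ^ 2 - n.+1)).
rewrite /theta_part (@big_cat_nat _ _ _ n.+1) //= mulr_sumr; congr (_ + _).
apply: eq_big_nat => s /andP[lts _]; rewrite mulrCA -exprD subnKC //.
by rewrite (leq_trans lts) // expnS expn1 leq_pmulr // (leq_ltn_trans _ lts).
Qed.

(** Length and precision are separate because the products in -q and -q^3 run up to 2N, those in q^2
    and q^6 only up to N. *)
Lemma gauss_identity_trunc m n : (n <= m)%N -> exists e,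
  gauss_prod 0 m = 1 + 2 * theta_part n + x ^+ n.+1 * e.
Proof.
move=> lenm; have [e ->] := gauss_identity m.
have [f ->] := theta_part_trunc lenm.
exists (2 * f + x ^+ (m - n) * e).
by rewrite -[m in X in _ + X](subnKC lenm) -addSn exprD; ring.
Qed.

End Gauss.

(** * Theta expansion of the generating function *)

Lemma fps_unit0 (f : fps) : f 0%N = 1 -> f \is a GRing.unit.
Proof. by move=> f0; rewrite /in_mem /= /fps_unit f0. Qed.

Lemma fps_expr0 (x : fps) k : x 0%N = 0 -> (0 < k)%N -> (x ^+ k) 0%N = 0.
Proof. by move=> x0 k_gt0; apply: fps_expr_lt. Qed.

Lemma fps_unitD1 (x : fps) k :
  x 0%N = 0 -> (0 < k)%N -> 1 + x ^+ k \is a GRing.unit.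
Proof. by move=> x0 k0; rewrite fps_unit0 // fpsD fps_expr0. Qed.

Lemma fps_unitB1 (x : fps) k :
  x 0%N = 0 -> (0 < k)%N -> 1 - x ^+ k \is a GRing.unit.
Proof. by move=> x0 k0; rewrite fps_unit0 // fpsD fpsN fps_expr0. Qed.

Lemma fps_qX0 a : (0 < a)%N -> (fps_q ^+ a) 0%N = 0.
Proof. by case: a => // a _; rewrite fps_qXn. Qed.

Lemma fps_qXN0 a : (0 < a)%N -> (- fps_q ^+ a) 0%N = 0.
Proof. by move=> a0; rewrite fpsN fps_qX0. Qed.

(** At x = -q the even indices of the Gauss product reproduce the product at q^2, and the odd ones
    give (1 + q^i) / (1 - q^i). The same holds for -q^3 and q^6, so the quotient leaves exactly the
    odd-index factors of [S3_factor]. *)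
Lemma S3_prod_gauss N :
  \prod_(1 <= k < N.+1) S3_factor k * gauss_prod (fps_q ^+ 2) 0 N
    * gauss_prod (- fps_q ^+ 3) 0 (2 * N)
  = gauss_prod (- fps_q ^+ 1) 0 (2 * N) * gauss_prod (fps_q ^+ 6) 0 N.
Proof.
elim: N => [|N IHN]; first by rewrite /gauss_prod !big_geq // !mulr1.
rewrite mulnS !add2n !gauss_prod_recr // big_nat_recr //=.
set F := \prod_(_ <= _ < _) _ in IHN *.
set g2 := gauss_prod _ _ _ in IHN *; set g3 := gauss_prod _ _ _ in IHN *.
set g1 := gauss_prod _ _ _ in IHN *; set g6 := gauss_prod _ _ _ in IHN *.
rewrite /S3_factor.
have -> : (2 * N.+1 - 1 = (2 * N).+1)%N by lia.
set o := (2 * N).+1.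
have sign_o : (-1) ^+ o = -1 :> fps by rewrite -signr_odd /= mul2n odd_double.
have sign_o1 : (-1) ^+ o.+1 = 1 :> fps by rewrite exprS sign_o mulrNN mulr1.
have negX m k : (- fps_q ^+ m) ^+ k = (-1) ^+ k * fps_q ^+ (m * k).
  by rewrite [LHS]exprNn -exprM.
rewrite !negX. rewrite sign_o sign_o1 !mul1r !mulN1r !opprK -!exprM !mul1n.
have -> : (6 * N.+1 = 3 * o.+1)%N by rewrite /o; lia.
have -> : (2 * N.+1 = o.+1)%N by rewrite /o; lia.
have q0 : fps_q 0%N = 0 by [].
have := fps_unitD1 q0 (isT : 0 < 3 * o)%N.
have := fps_unitB1 q0 (isT : 0 < 3 * o)%N.
set c := 1 - fps_q ^+ (3 * o); set d := 1 + fps_q ^+ (3 * o) => Uc Ud.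
have Ub := fps_unitB1 q0 (isT : 0 < o)%N.
rewrite invrM //.
set a := 1 + fps_q ^+ o; set b := 1 - fps_q ^+ o in Ub *.
set u := (1 - fps_q ^+ (3 * o.+1)) / _; set v := (1 - _) / (1 + fps_q ^+ o.+1).
(* The factor d / c of [g3] at the odd index [o] cancels c / d in [S3_factor]. *)
transitivity (F * g2 * g3 * (a * b^-1 * u * v) * (c * c^-1) * (d * d^-1)).
  by ring.
rewrite IHN !divrr // !mulr1; ring.
Qed.

(** A truncation of (phi(q^a) - 1) / 2. *)
Definition theta (a N : nat) : fps := \sum_(1 <= s < N.+1) fps_q ^+ (a * s ^ 2).
Definition theta_odd (a N : nat) : fps :=
  \sum_(1 <= s < N.+1 | odd s) fps_q ^+ (a * s ^ 2).

Lemma signr_sqr (R : pzRingType) s : (-1) ^+ (s ^ 2) = (-1) ^+ s :> R.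
Proof. by rewrite -signr_odd oddX /= signr_odd. Qed.

Lemma theta_partN a N : theta_part (- fps_q ^+ a) N = theta a N.
Proof.
apply: eq_bigr => s _.
by rewrite [X in _ * X]exprNn signr_sqr mulrA -expr2 sqrr_sign mul1r exprM.
Qed.

Lemma theta_part_odd a N :
  theta_part (fps_q ^+ a) N = theta a N - 2 * theta_odd a N.
Proof.
rewrite /theta /theta_odd [X in _ - _ * X]big_mkcond mulr_sumr -sumrB.
apply: eq_bigr => s _; rewrite -exprM -signr_odd.
by case: (odd s); rewrite ?expr1 ?expr0; ring.
Qed.

Lemma thetaS a N : theta a N.+1 = theta a N + fps_q ^+ (a * N.+1 ^ 2).
Proof. by rewrite /theta big_nat_recr. Qed.

(** Squaring is additive modulo 2, and it doubles each exponent. *)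
Lemma theta_sqr a N :
  exists h, theta a N ^+ 2 = theta (2 * a) N + 2 * h.
Proof.
elim: N => [|N [h IHN]].
  by exists 0; rewrite /theta !big_geq //; ring.
rewrite !thetaS; exists (h + theta a N * fps_q ^+ (a * N.+1 ^ 2)).
rewrite sqrrD IHN -exprM [(_ * 2)%N]mulnC [(2 * (a * _))%N]mulnA -mulr_natl.
by ring.
Qed.

(** Since (1 + 2s)(1 - 2s + 4s^2) = 1 + 8s^3, division modulo 8 is polynomial. Here [y] stands for
    q^(N+1), and [a], [b], [c], [d] for the truncation errors. *)
Lemma quotient_mod8 (R : comPzRingType) (F A B B' C D D' y a b c d : R) :
  F * (1 + 2 * (B - 2 * B') + y * b) * (1 + 2 * C + y * c)
    = (1 + 2 * A + y * a) * (1 + 2 * (D - 2 * D') + y * d) ->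
  exists h e,
    F = 1 + 2 * (A + D - B - C) + 4 * (B' - D')
        + 4 * (A * D + (A + D) * (B + C) + B * C + B ^+ 2 + C ^+ 2)
        + 8 * h + y * e.
Proof.
set s := B - 2 * B'; set t := D - 2 * D' => FE.
(* X and Y invert 1 + 2s and 1 + 2C modulo 8. *)
pose X := 1 - 2 * s + 4 * s ^+ 2; pose Y := 1 - 2 * C + 4 * C ^+ 2.
pose V := 1 + 8 * C ^+ 3 + y * (c * Y).
pose u := A + t; pose v := A * t; pose w := s + C.
pose z := s ^+ 2 + C ^+ 2 + s * C.
pose k := 2 * s ^+ 2 * C ^+ 2 - s ^+ 2 * C - s * C ^+ 2.
(* Expand (1 + 2A)(1 + 2t) = 1 + 2u + 4v times XY = 1 - 2w + 4z + 8k, writing -4uw as 4uw - 8uw. The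
   remaining terms come from replacing [s], [t] by [B], [D] and from the cubes 8s^3 and 8C^3. *)
exists (k + u * z - u * w - v * w + 2 * (u * k) + 2 * (v * z) + 4 * (v * k)
  - A * D' - B' * (A + D) - D' * (B + C) + 2 * (D' * B') - B' * C
  - 2 * (B * B') + 2 * B' ^+ 2 - F * (s ^+ 3 * V + C ^+ 3)).
exists ((a * (1 + 2 * t + y * d) + (1 + 2 * A) * d) * (X * Y)
  - F * (b * X * V + c * Y)).
transitivity (F * (1 + 2 * s + y * b) * (1 + 2 * C + y * c) * (X * Y)
    - 8 * (F * (s ^+ 3 * V + C ^+ 3)) - y * (F * (b * X * V + c * Y))).
  by rewrite /V /X /Y; ring.
rewrite FE /V /X /Y /u /v /w /z /k /s /t; ring.
Qed.

Lemma gauss_fps (x : fps) m n : x 0%N = 0 -> (n <= m)%N -> exists e,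
  gauss_prod x 0 m = 1 + 2 * theta_part x n + x ^+ n.+1 * e.
Proof.
by move=> x0; apply: gauss_identity_trunc => k k_gt0; apply: fps_unitD1.
Qed.

(* [h] and [e] witness a congruence modulo 8 and q^(N+1). *)
Lemma S3_theta N : exists h e : fps,
  let A := theta 1 N in let B := theta 2 N in
  let C := theta 3 N in let D := theta 6 N in
  \prod_(1 <= k < N.+1) S3_factor k
  = 1 + 2 * (A + D - B - C) + 4 * (theta_odd 2 N - theta_odd 6 N)
    + 4 * (A * D + (A + D) * (B + C) + B * C + B ^+ 2 + C ^+ 2) + 8 * h
    + fps_q ^+ N.+1 * e.
Proof.
have le2 : (N <= 2 * N)%N by lia.
have [e1] := gauss_fps (fps_qXN0 (isT : 0 < 1)%N) le2.
have [e2] := gauss_fps (fps_qX0 (isT : 0 < 2)%N) (leqnn N).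
have [e3] := gauss_fps (fps_qXN0 (isT : 0 < 3)%N) le2.
have [e6] := gauss_fps (fps_qX0 (isT : 0 < 6)%N) (leqnn N).
have := S3_prod_gauss N.
set F := \prod_(_ <= _ < _) _.
set g2 := gauss_prod _ _ _; set g3 := gauss_prod _ _ _.
set g1 := gauss_prod _ _ _; set g6 := gauss_prod _ _ _ => FE.
rewrite !theta_partN !theta_part_odd.
(* All four error terms are brought to the common factor q^(N+1). *)
have negX a k : (- fps_q ^+ a.+1) ^+ k = fps_q ^+ k * ((-1) ^+ k * fps_q ^+ (a * k)).
  by rewrite [LHS]exprNn -exprM mulSn exprD mulrCA.
have posX a k : (fps_q ^+ a.+1) ^+ k = fps_q ^+ k * fps_q ^+ (a * k).
  by rewrite -exprM mulSn exprD.
rewrite !negX !posX -!mulrA.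
set y := fps_q ^+ N.+1.
set A := theta 1 N; set B := theta 2 N.
set C := theta 3 N; set D := theta 6 N.
set B' := theta_odd 2 N; set D' := theta_odd 6 N.
move: (_ * e6) (_ * e3) (_ * e2) (_ * e1) => d c b a.
move=> g6E g3E g2E g1E; move: FE; rewrite {}g6E {}g3E {}g2E {}g1E => FE.
exact: quotient_mod8 FE.
Qed.

(** * Coefficients as representation counts *)

Section Counts.
Local Open Scope nat_scope.

(** For a > 0 and n < K the bound excludes no positive solution; a free [K] lets counts at n and at
    a multiple of n use proportional ranges. *)
Definition sq (a K n : nat) : nat := \sum_(1 <= x < K) (n == a * x ^ 2).

Definition sq_odd (a K n : nat) : nat :=
  \sum_(1 <= x < K | odd x) (n == a * x ^ 2).

Definition rep (a b K n : nat) : nat :=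
  \sum_(1 <= x < K) \sum_(1 <= y < K) (n == a * x ^ 2 + b * y ^ 2).

End Counts.

Lemma theta_coef a N n : theta a N n = (sq a N.+1 n)%:R.
Proof.
rewrite fps_sum natr_sum; apply: eq_bigr => x _; exact: fps_qXn.
Qed.

Lemma theta_odd_coef a N n : theta_odd a N n = (sq_odd a N.+1 n)%:R.
Proof.
rewrite fps_sum natr_sum; apply: eq_bigr => x _; exact: fps_qXn.
Qed.

Lemma thetaM_coef a b N n : (theta a N * theta b N) n = (rep a b N.+1 n)%:R.
Proof.
rewrite mulr_suml fps_sum natr_sum; apply: eq_bigr => x _.
rewrite mulr_sumr fps_sum natr_sum; apply: eq_bigr => y _.
by rewrite -exprD fps_qXn.
Qed.

Lemma fps_natM (c : nat) (f : fps) n : (c%:R * f) n = c%:R * f n.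
Proof.
rewrite !mulr_natl; elim: c => [|c IHc]; first by rewrite !mulr0n fps0.
by rewrite !mulrS fpsD IHc.
Qed.

Lemma fps_qXM_lt m (f : fps) n : (n < m)%N -> (fps_q ^+ m * f) n = 0.
Proof.
move=> ltnm; rewrite fpsM big1 // => i _.
by rewrite fps_qXn (ltn_eqF (leq_trans (ltn_ord i) ltnm)) mul0r.
Qed.

Lemma S3bar_prod n N : (n <= N)%N ->
  S3bar n = (\prod_(1 <= k < N.+1) S3_factor k) n.
Proof.
elim: N => [|N IHN]; first by rewrite leqn0 => /eqP->.
rewrite leq_eqVlt => /orP[/eqP-> // | ltnN].
rewrite big_nat_recr // (@fps_eq1mod_mulr N.+1) ?IHN //.
exact: S3_factor_eq1mod.
Qed.

(** The error q^(N+1) [e] does not reach degree n. By [theta_sqr], 4B^2 and 4C^2 become the terms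
    [s 4] and [s 6] modulo 8. *)
Lemma S3bar_mod8 n K : (n < K)%N -> exists h : int,
  let s a := (sq a K n)%:R in let so a := (sq_odd a K n)%:R in
  let r a b := (rep a b K n)%:R in
  S3bar n = (n == 0%N)%:R + 2 * (s 1%N + s 6%N - s 2%N - s 3%N)
    + 4 * (so 2%N - so 6%N)
    + 4 * (r 1%N 6%N + r 1%N 2%N + r 1%N 3%N + r 2%N 6%N + r 3%N 6%N + r 2%N 3%N
           + s 4%N + s 6%N) + 8 * h.
Proof.
case: K => // N; rewrite ltnS => lenN; rewrite (S3bar_prod lenN).
have [h [e ->]] := S3_theta N.
have [h2 ->] := theta_sqr 2 N; have [h3 ->] := theta_sqr 3 N.
exists ((h + h2 + h3) n); cbv beta zeta.
rewrite -!theta_coef -!theta_odd_coef -!thetaM_coef -fps1.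
set A := theta 1 N; set B := theta 2 N; set C := theta 3 N; set D := theta 6 N.
set X := theta 4 N; set b := theta_odd 2 N; set d := theta_odd 6 N.
set y := _ ^+ _.
transitivity ((1 + 2%:R * (A + D - B - C) + 4%:R * (b - d) +
  4%:R * (A * D + A * B + A * C + B * D + C * D + B * C + X + D)
  + 8%:R * (h + h2 + h3) + y * e : fps) n).
  by congr (coefs _ n); ring.
by rewrite !(fpsD, fpsN, fps_natM) fps_qXM_lt // addr0.
Qed.

(** * Odd solutions of 2M = x^2 + 3y^2 *)

Section OddSolutions.
Local Open Scope nat_scope.

(** Ordering by [enum_rank], [f] exchanges the points it raises with those it lowers, so the points
    it moves are even in number. *)
Lemma odd_card_involution (T : finType) (A : {set T}) (f : T -> T) :
  {in A, forall x, f x \in A} -> {in A, involutive f} ->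
  odd #|A| = odd #|[set x in A | f x == x]|.
Proof.
move=> fA fK; pose r (x : T) : nat := enum_rank x.
pose B := [set x in A | r x < r (f x)]; pose C := [set x in A | r (f x) < r x].
have CE : C = f @: B.
  apply/setP=> x; rewrite inE; apply/andP/imsetP => [[xA lt]|[y]].
    by exists (f x); rewrite ?inE ?fA ?fK.
  by rewrite inE => /andP[yA lt] ->; rewrite fA ?fK.
have cC : #|C| = #|B|.
  rewrite CE card_in_imset // => x y; rewrite !inE => /andP[xA _] /andP[yA _].
  by move=> /(congr1 f); rewrite !fK.
rewrite -(cardsID [set x | f x == x] A) -setIdE oddD.
rewrite -(cardsID [set x | r x < r (f x)] (_ :\: _)).
have -> : (A :\: [set x | f x == x]) :&: [set x | r x < r (f x)] = B.
  apply/setP=> x; rewrite !inE; case: (x \in A); rewrite ?andbF ?andbT //=.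
  by case: eqP => // ->; rewrite ltnn.
have -> : (A :\: [set x | f x == x]) :\: [set x | r x < r (f x)] = C.
  apply/setP=> x; rewrite !inE; case: (x \in A); rewrite ?andbF ?andbT //=.
  have -> : (f x == x) = (r (f x) == r x).
    by apply/eqP/eqP => [->//|/ord_inj/enum_rank_inj].
  by rewrite -leqNgt ltn_neqAle andbC.
by rewrite cC oddD addbb addbF.
Qed.

(* In Z[(1 + sqrt -3)/2], up to conjugation and sign, this is multiplication
   of x + y sqrt -3 by the primitive cube root of unity which keeps both
   coordinates odd. *)
Definition eisenstein_rot (p : nat * nat) : nat * nat :=
  let: (x, y) := p in
  if x %% 4 == y %% 4 then (((x - 3 * y) + (3 * y - x))./2, (x + y)./2)
  else ((x + 3 * y)./2, ((x - y) + (y - x))./2).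

(** The sum of the two truncated differences is an absolute value. In either branch both numbers to
    be halved are 2 modulo 4. *)
Lemma eisenstein_rot_odd x y : odd x -> odd y ->
  odd (eisenstein_rot (x, y)).1 /\ odd (eisenstein_rot (x, y)).2.
Proof. by move=> ox oy; rewrite /=; case: eqP => /= ?; split; lia. Qed.

(** Of the three multiples of x + y sqrt -3 by cube roots of unity, exactly two have odd
    coordinates; the map swaps these two, up to conjugation and sign. *)
Lemma eisenstein_rotK x y : odd x -> odd y ->
  eisenstein_rot (eisenstein_rot (x, y)) = (x, y).
Proof.
by move=> ox oy; rewrite /=; case: eqP => e /=; case: eqP => e' /=;
  congr pair; lia.
Qed.

Lemma eisenstein_rot_norm x y : odd x -> odd y ->
  (eisenstein_rot (x, y)).1 ^ 2 + 3 * (eisenstein_rot (x, y)).2 ^ 2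
  = x ^ 2 + 3 * y ^ 2.
Proof.
move=> ox oy; rewrite /=; case: eqP => e /=.
  set u := _./2; set v := _./2.
  have [|] := leqP (3 * y) x => h.
    have ux : x = u.*2 + 3 * y by rewrite /u; lia.
    have vy : v = u + y.*2 by rewrite /v; lia.
    by clearbody u v; rewrite vy ux; lia.
  have uy : x + u.*2 = 3 * y by rewrite /u; lia.
  have vy : v.*2 = x + y by rewrite /v; lia.
  by clearbody u v; nia.
set u := _./2; set v := _./2.
have uy : u.*2 = x + 3 * y by rewrite /u; lia.
have [|] := leqP y x => h.
  have vy : v.*2 + y = x by rewrite /v; lia.
  by clearbody u v; nia.
have vy : v.*2 + x = y by rewrite /v; lia.
by clearbody u v; nia.
Qed.

Lemma eisenstein_rot_fix x y : odd x -> odd y ->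
  eisenstein_rot (x, y) = (x, y) <-> x = y \/ x = 3 * y.
Proof.
move=> ox oy; rewrite /=; case: eqP => e; split.
- by case=> h1 h2; lia.
- by case=> ?; congr pair; lia.
- by case=> h1 h2; lia.
- by case=> ?; congr pair; lia.
Qed.

Lemma sum_odd_ord (F : nat -> nat) n :
  \sum_(1 <= x < n.+1 | odd x) F x = \sum_(x < n.+1 | odd x) F x.
Proof. by rewrite -(big_mkord odd) [RHS]big_mkcond big_ltn // -big_mkcond. Qed.

(** Only fixed points of [eisenstein_rot] count modulo 2. Those with x = y give M = 2x^2; those with
    x = 3y would give M = 6y^2, contrary to 3 not dividing M. *)
Lemma odd_reps_parity M m : ~~ (3 %| M) -> 2 * M <= m ->
  odd (\sum_(1 <= x < m.+1 | odd x) \sum_(1 <= y < m.+1 | odd y)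
         (2 * M == x ^ 2 + 3 * y ^ 2))
  = odd (\sum_(1 <= x < m.+1 | odd x) (M == 2 * x ^ 2)).
Proof.
move=> nM leMm; rewrite !sum_odd_ord.
pose A := [set p : 'I_m.+1 * 'I_m.+1 |
  [&& odd p.1, odd p.2 & 2 * M == p.1 ^ 2 + 3 * p.2 ^ 2]].
pose rot (p : 'I_m.+1 * 'I_m.+1) := eisenstein_rot (p.1 : nat, p.2 : nat).
(* On [A] the default of [inord] is never taken: each coordinate is at most its square, hence at
   most 2M <= m. *)
pose f p : 'I_m.+1 * 'I_m.+1 := (inord (rot p).1, inord (rot p).2).
have fE p : p \in A -> f p \in A /\ ((f p).1 : nat, (f p).2 : nat) = rot p.
  rewrite inE => /and3P[o1 o2 /eqP e].
  have [r1 r2] := eisenstein_rot_odd o1 o2.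
  have := eisenstein_rot_norm o1 o2; rewrite -/(rot p) -e => er.
  have sqr_ge u : u <= u ^ 2 by case: u => // u; rewrite leq_pmulr.
  have := sqr_ge (rot p).1; have := sqr_ge (rot p).2 => le2 le1.
  have n1 : (f p).1 = (rot p).1 :> nat by rewrite inordK //; lia.
  have n2 : (f p).2 = (rot p).2 :> nat by rewrite inordK //; lia.
  by rewrite inE n1 n2 r1 r2 er eqxx -surjective_pairing.
have valI (p r : 'I_m.+1 * 'I_m.+1) :
    (p.1 : nat, p.2 : nat) = (r.1 : nat, r.2 : nat) -> p = r.
  by case: p r => [? ?] [? ?] /= [/val_inj-> /val_inj->].
have -> : \sum_(x < m.+1 | odd x) \sum_(1 <= y < m.+1 | odd y)
    (2 * M == x ^ 2 + 3 * y ^ 2) = #|A|.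
  rewrite -sum1dep_card.
  rewrite (eq_bigr _ (fun x _ => sum_odd_ord _ m)) pair_big /= [LHS]big_mkcond [RHS]big_mkcond; apply: eq_bigr => p _.
  by case: (odd p.1); case: (odd p.2); case: eqP.
rewrite (@odd_card_involution _ _ f).
- pose B := [set x : 'I_m.+1 | odd x && (M == 2 * x ^ 2)].
  have -> : \sum_(x < m.+1 | odd x) (M == 2 * x ^ 2) = #|B|.
    rewrite -sum1dep_card [LHS]big_mkcond [RHS]big_mkcond.
    by apply: eq_bigr => x _; case: (odd x); case: eqP.
  rewrite -(@card_imset _ _ (fun x => (x, x)) B); last by move=> x y [].
  congr (odd #|pred_of_set _|); apply/setP=> p; rewrite inE.
  apply/andP/imsetP => [[pA /eqP fp] | [x]].
    have [_] := fE p pA; rewrite fp => /esym rp.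
    move: pA; rewrite inE => /and3P[o1 o2 /eqP e].
    have [e12 | e12] := (eisenstein_rot_fix o1 o2).1 rp.
      exists p.1; last by apply: valI; rewrite /= e12.
      by rewrite inE o1; move: e; rewrite e12; lia.
    case/negP: nM; rewrite e12 in e.
    apply/dvdnP; exists (2 * p.2 ^ 2).
    by move: e; rewrite expnMn; move: (p.2 ^ 2) => z; lia.
  rewrite inE => /andP[ox /eqP e] ->.
  have pA : (x, x) \in A by rewrite inE /= ox /=; apply/eqP; lia.
  split=> //; apply/eqP/valI; have [_ ->] := fE _ pA.
  by apply/eisenstein_rot_fix => //; left.
- by move=> p /fE[].
- move=> p pA; have [fA fv] := fE p pA; apply: valI; have [_ ->] := fE _ fA.
  rewrite /rot fv /rot; move: pA; rewrite inE => /and3P[o1 o2 _].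
  exact: eisenstein_rotK.
Qed.

End OddSolutions.

(** * Scaling by 2, 3 and 4 *)

Section FormCounts.
Local Open Scope nat_scope.

Lemma sqr_mod3 x : if 3 %| x then x ^ 2 %% 3 = 0 else x ^ 2 %% 3 = 1.
Proof.
rewrite -modnXm /dvdn; have : x %% 3 < 3 by rewrite ltn_mod.
by case: (x %% 3) => [|[|[|]]].
Qed.

Lemma sqr_mod8 x : if odd x then x ^ 2 %% 8 = 1 else x ^ 2 %% 4 = 0.
Proof.
have -> : odd x = odd (x %% 8) by lia.
have [<- <-] : (x %% 8) ^ 2 %% 8 = x ^ 2 %% 8 /\ (x %% 8) ^ 2 %% 4 = x ^ 2 %% 4.
  split; first exact: modnXm.
  by rewrite -modnXm (modn_dvdm x (isT : 4 %| 8)) modnXm.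
have : x %% 8 < 8 by rewrite ltn_mod.
by case: (x %% 8) => [|[|[|[|[|[|[|[|]]]]]]]].
Qed.

Lemma sum_scale p K (f : nat -> nat) : 0 < p -> 0 < K ->
  (forall x, ~~ (p %| x) -> f x = 0) ->
  \sum_(1 <= x < p * K) f x = \sum_(1 <= x < K) f (p * x).
Proof.
move=> p_gt0 + f0; elim: K => // -[_ _|K IHK _].
  rewrite muln1 [RHS]big_geq // big_nat big1 // => x /andP[x_gt0 ltxp].
  by rewrite f0 // gtnNdvd.
rewrite [RHS]big_nat_recr // -IHK // (@big_cat_nat _ _ _ (p * K.+1)) //=;
  try nia.
congr (_ + _); rewrite big_ltn; last by nia.
rewrite big_nat big1 ?addn0 // => x /andP[lt1 lt2].
rewrite f0 //; apply/negP => /dvdnP[k xE].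
by move: lt1 lt2; rewrite xE [k * p]mulnC !ltn_pmul2l //; lia.
Qed.

Lemma sum_even K (f : nat -> nat) : 0 < K ->
  \sum_(1 <= x < 2 * K | ~~ odd x) f x = \sum_(1 <= x < K) f (2 * x).
Proof.
move=> K_gt0; rewrite big_mkcond sum_scale //.
  by apply: eq_bigr => x _; rewrite mul2n odd_double.
by move=> x; rewrite dvdn2 negbK => ->.
Qed.

Lemma sq_scale p a b K m n : 0 < p -> 0 < K ->
  (forall x, m = a * x ^ 2 -> p %| x) ->
  (forall x, (m == a * (p * x) ^ 2) = (n == b * x ^ 2)) ->
  sq a (p * K) m = sq b K n.
Proof.
move=> p_gt0 K_gt0 m_p mn; rewrite /sq sum_scale //.
  by apply: eq_bigr => x _; rewrite mn.
by move=> x; case: eqP => // /m_p ->.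
Qed.

Lemma sq_trunc a K K' n : 0 < a -> n < K -> K <= K' -> sq a K' n = sq a K n.
Proof.
move=> a_gt0 ltnK leK; rewrite /sq (@big_cat_nat _ _ _ K) //=; last by lia.
rewrite [X in _ + X]big_nat [X in _ + X]big1 ?addn0 // => x /andP[leKx _].
by case: eqP => // nE; move: nE; nia.
Qed.

Lemma sq_eq0 a K n : (forall x, n != a * x ^ 2) -> sq a K n = 0.
Proof. by move=> h; apply: big1 => x _; rewrite (negbTE (h x)). Qed.

Lemma sq_odd_eq0 a K n :
  (forall x, odd x -> n != a * x ^ 2) -> sq_odd a K n = 0.
Proof. by move=> h; apply: big1 => x ox; rewrite (negbTE (h x ox)). Qed.

Lemma rep_eq0 a b K n :
  (forall x y, n != a * x ^ 2 + b * y ^ 2) -> rep a b K n = 0.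
Proof. by move=> h; rewrite /rep !big1 // => x _; rewrite big1 // => y _;
  rewrite (negbTE (h x y)). Qed.

Definition rep_odd a b K n :=
  \sum_(1 <= x < K | odd x) \sum_(1 <= y < K | odd y)
    (n == a * x ^ 2 + b * y ^ 2).

(** Solutions with both coordinates even are halved to solutions for n; the both-odd ones remain. *)
Lemma rep_split a b K n : 0 < K ->
  (forall x y, 4 * n = a * x ^ 2 + b * y ^ 2 -> odd x = odd y) ->
  rep a b (2 * K) (4 * n) = rep_odd a b (2 * K) (4 * n) + rep a b K n.
Proof.
move=> K_gt0 oxy; rewrite /rep (bigID odd) /=; congr (_ + _).
  apply: eq_bigr => x ox; rewrite [LHS](bigID odd) /= [X in _ + X]big1 ?addn0 //.
  move=> y oy; case: eqP => // /oxy; rewrite ox => e.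
  by rewrite -e in oy.
rewrite sum_even //; apply: eq_bigr => x _.
rewrite (bigID odd) /= big1 ?add0n; last first.
  by move=> y oy; case: eqP => // /oxy; rewrite oy mul2n odd_double.
rewrite sum_even //; apply: eq_bigr => y _; congr (nat_of_bool _).
by rewrite !expnMn; apply/eqP/eqP; lia.
Qed.

Lemma rep_scale a b K n : 0 < K ->
  (forall x y, 4 * n = a * x ^ 2 + b * y ^ 2 -> ~~ odd x && ~~ odd y) ->
  rep a b (2 * K) (4 * n) = rep a b K n.
Proof.
move=> K_gt0 h; rewrite rep_split //; last first.
  by move=> x y /h /andP[/negbTE-> /negbTE->].
rewrite /rep_odd big1 // => x ox; rewrite big1 // => y oy.
by case: eqP => // /h; rewrite ox.
Qed.

End FormCounts.

(** * The congruences modulo 4 *)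

Lemma eqz_modP (d x y : int) :
  (exists h, x = y + d * h) <-> (x = y %[mod d])%Z.
Proof.
split=> [[h ->] | /eqP]; first by rewrite addrC mulrC modzMDl.
rewrite eqz_mod_dvd => /dvdzP[h xy]; exists h.
by rewrite mulrC -xy addrC subrK.
Qed.

(** As -2 = 2 modulo 4, the signs of the single-square terms disappear. *)
Lemma S3bar_mod4 n K : (n < K)%N ->
  (S3bar n = ((n == 0%N) + 2 * (sq 1 K n + sq 2 K n + sq 3 K n + sq 6 K n))%N
     %[mod 4])%Z.
Proof.
move=> ltnK; apply/eqz_modP; have [h ->] := S3bar_mod8 ltnK.
set r := _ + _ + (sq 6 K n)%:R; set u := _ - (sq_odd 6 K n)%:R.
exists (u + r + 2 * h - (sq 2 K n)%:R - (sq 3 K n)%:R).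
rewrite PoszD PoszM !PoszD -!natz; ring.
Qed.

Lemma S3bar_mul3_mod4 n : (S3bar (3 * n)%N = S3bar n %[mod 4])%Z.
Proof.
have le3 : (3 * n < 3 * n.+1)%N by lia.
rewrite (S3bar_mod4 le3) (S3bar_mod4 (ltnSn n)).
have -> : sq 1 (3 * n.+1) (3 * n) = sq 3 n.+1 n.
  apply: sq_scale => // x; last by apply/eqP/eqP; lia.
  by have := sqr_mod3 x; case: (3 %| x)%N => //; lia.
have -> : sq 2 (3 * n.+1) (3 * n) = sq 6 n.+1 n.
  apply: sq_scale => // x; last by apply/eqP/eqP; lia.
  by have := sqr_mod3 x; case: (3 %| x)%N => //; lia.
have -> : sq 3 (3 * n.+1) (3 * n) = sq 1 n.+1 n.
  rewrite -(@sq_trunc 1 n.+1 (3 * n.+1)) //; last by lia.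
  by apply: eq_bigr => x _; congr nat_of_bool; apply/eqP/eqP; lia.
have -> : sq 6 (3 * n.+1) (3 * n) = sq 2 n.+1 n.
  rewrite -(@sq_trunc 2 n.+1 (3 * n.+1)) //; last by lia.
  by apply: eq_bigr => x _; congr nat_of_bool; apply/eqP/eqP; lia.
congr modz; congr Posz; lia.
Qed.

Lemma S3bar_mul2_mod4 n : (S3bar (2 * n)%N = S3bar n %[mod 4])%Z.
Proof.
have le2 : (2 * n < 2 * n.+1)%N by lia.
rewrite (S3bar_mod4 le2) (S3bar_mod4 (ltnSn n)).
have -> : sq 1 (2 * n.+1) (2 * n) = sq 2 n.+1 n.
  apply: sq_scale => // x; last by apply/eqP/eqP; lia.
  by rewrite dvdn2; have := sqr_mod8 x; case: odd => //; lia.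
have -> : sq 3 (2 * n.+1) (2 * n) = sq 6 n.+1 n.
  apply: sq_scale => // x; last by apply/eqP/eqP; lia.
  by rewrite dvdn2; have := sqr_mod8 x; case: odd => //; lia.
have -> : sq 2 (2 * n.+1) (2 * n) = sq 1 n.+1 n.
  rewrite -(@sq_trunc 1 n.+1 (2 * n.+1)) //; last by lia.
  by apply: eq_bigr => x _; congr nat_of_bool; apply/eqP/eqP; lia.
have -> : sq 6 (2 * n.+1) (2 * n) = sq 3 n.+1 n.
  rewrite -(@sq_trunc 3 n.+1 (2 * n.+1)) //; last by lia.
  by apply: eq_bigr => x _; congr nat_of_bool; apply/eqP/eqP; lia.
congr modz; congr Posz; lia.
Qed.

(** * The congruences modulo 8 *)

Lemma sq_dvd3_eq0 a K n : ~~ (3 %| n)%N -> (3 %| a)%N -> sq a K n = 0%N.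
Proof.
move=> n3 a3; apply: sq_eq0 => x.
by apply: contraNneq n3 => ->; rewrite dvdn_mulr.
Qed.

Lemma sq_odd_dvd3_eq0 a K n :
  ~~ (3 %| n)%N -> (3 %| a)%N -> sq_odd a K n = 0%N.
Proof.
move=> n3 a3; apply: sq_odd_eq0 => x _.
by apply: contraNneq n3 => ->; rewrite dvdn_mulr.
Qed.

Lemma rep_dvd3_eq0 a b K n :
  ~~ (3 %| n)%N -> (3 %| a)%N -> (3 %| b)%N -> rep a b K n = 0%N.
Proof.
move=> n3 a3 b3; apply: rep_eq0 => x y.
by apply: contraNneq n3 => ->; rewrite dvdn_add // dvdn_mulr.
Qed.

Lemma sq_odd_trunc a K K' n :
  (0 < a)%N -> (n < K)%N -> (K <= K')%N -> sq_odd a K' n = sq_odd a K n.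
Proof.
move=> a_gt0 ltnK leK; rewrite /sq_odd !(big_mkcond odd) /=.
rewrite (@big_cat_nat _ _ _ K) //=; last by lia.
rewrite [X in (_ + X)%N]big_nat [X in (_ + X)%N]big1 ?addn0 // => x /andP[leKx _].
by case: ifP => // _; case: eqP => // nE; move: nE; nia.
Qed.

Lemma S3bar_mod8_coprime3 n K : (n < K)%N -> ~~ (3 %| n)%N -> exists h : int,
  let s a := (sq a K n)%:R in let r a b := (rep a b K n)%:R in
  S3bar n = 2 * (s 1%N - s 2%N) + 4 * (sq_odd 2 K n)%:R
    + 4 * (r 1%N 6%N + r 1%N 2%N + r 1%N 3%N + r 2%N 6%N + r 2%N 3%N + s 4%N)
    + 8 * h.
Proof.
move=> ltnK n3; have [h ->] := S3bar_mod8 ltnK; exists h; cbv beta zeta.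
have -> : (n == 0%N)%:R = 0 :> int by case: n n3 {ltnK}.
rewrite (@sq_dvd3_eq0 3) // (@sq_dvd3_eq0 6) // (@sq_odd_dvd3_eq0 6) //.
rewrite (@rep_dvd3_eq0 3 6) // !mulr0n; ring.
Qed.

Ltac mod3_mod8 x y :=
  have := sqr_mod3 x; have := sqr_mod3 y; have := sqr_mod8 x;
  have := sqr_mod8 y; case: (3 %| x)%N; case: (3 %| y)%N;
  case: (odd x); case: (odd y) => //=; lia.

(** Residues modulo 3 remove 2x^2, 2x^2 + 6y^2 and 2x^2 + 3y^2. Evenness of n excludes odd x, y in
    4n = x^2 + 3y^2, where the right side is 4 modulo 8. *)
Lemma S3bar_mul4_mod8_1mod3 n : (n %% 3)%N = 1%N -> ~~ odd n ->
  (S3bar (4 * n)%N = S3bar n %[mod 8])%Z.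
Proof.
move=> n1 even_n; set K := (4 * n).+1.
have ltnK : (n < K)%N by lia.
have lt4nK : (4 * n < 2 * K)%N by lia.
have K_gt0 : (0 < K)%N by [].
apply/eqz_modP.
have [|h ->] := S3bar_mod8_coprime3 lt4nK; first by lia.
have [|h' ->] := S3bar_mod8_coprime3 ltnK; first by lia.
have -> : sq 1 (2 * K) (4 * n) = sq 1 K n.
  apply: sq_scale => // x; last by apply/eqP/eqP; lia.
  by rewrite dvdn2; mod3_mod8 x x.
have -> : sq 4 (2 * K) (4 * n) = sq 4 K n.
  apply: sq_scale => // x; last by apply/eqP/eqP; lia.
  by rewrite dvdn2; mod3_mod8 x x.
have z2 m L : (m %% 3)%N = 1%N -> sq 2 L m = 0%N.
  by move=> m1; apply: sq_eq0 => x; apply/eqP; mod3_mod8 x x.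
have zo2 m L : (m %% 3)%N = 1%N -> sq_odd 2 L m = 0%N.
  by move=> m1; apply: sq_odd_eq0 => x _; apply/eqP; mod3_mod8 x x.
have z26 m L : (m %% 3)%N = 1%N -> rep 2 6 L m = 0%N.
  by move=> m1; apply: rep_eq0 => x y; apply/eqP; mod3_mod8 x y.
have z23 m L : (m %% 3)%N = 1%N -> rep 2 3 L m = 0%N.
  by move=> m1; apply: rep_eq0 => x y; apply/eqP; mod3_mod8 x y.
have n4 : (4 * n %% 3)%N = 1%N by lia.
rewrite !z2 // !zo2 // !z26 // !z23 //.
rewrite (@rep_scale 1 6) //; last by move=> x y; mod3_mod8 x y.
rewrite (@rep_scale 1 2) //; last by move=> x y; mod3_mod8 x y.
rewrite (@rep_scale 1 3) //; last by move=> x y; mod3_mod8 x y.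
exists (h - h'); ring.
Qed.

Lemma S3bar_mul4_mod8_2mod3 n : (n %% 3)%N = 2%N ->
  (S3bar (4 * n)%N = S3bar n %[mod 8])%Z.
Proof.
move=> n2; set K := (4 * n).+1.
have ltnK : (n < K)%N by lia.
have lt4nK : (4 * n < 2 * K)%N by lia.
have K_gt0 : (0 < K)%N by [].
apply/eqz_modP.
have [|h ->] := S3bar_mod8_coprime3 lt4nK; first by lia.
have [|h' ->] := S3bar_mod8_coprime3 ltnK; first by lia.
have z1 m L : (m %% 3)%N = 2%N -> sq 1 L m = 0%N.
  by move=> m1; apply: sq_eq0 => x; apply/eqP; mod3_mod8 x x.
have z4 m L : (m %% 3)%N = 2%N -> sq 4 L m = 0%N.
  by move=> m1; apply: sq_eq0 => x; apply/eqP; mod3_mod8 x x.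
have z16 m L : (m %% 3)%N = 2%N -> rep 1 6 L m = 0%N.
  by move=> m1; apply: rep_eq0 => x y; apply/eqP; mod3_mod8 x y.
have z13 m L : (m %% 3)%N = 2%N -> rep 1 3 L m = 0%N.
  by move=> m1; apply: rep_eq0 => x y; apply/eqP; mod3_mod8 x y.
have n4 : (4 * n %% 3)%N = 2%N by lia.
rewrite !z1 // !z4 // !z16 // !z13 //.
have -> : sq 2 (2 * K) (4 * n) = sq 2 K n.
  apply: sq_scale => // x; last by apply/eqP/eqP; lia.
  by rewrite dvdn2; mod3_mod8 x x.
have -> : sq_odd 2 (2 * K) (4 * n) = 0%N.
  by apply: sq_odd_eq0 => x ox; apply/eqP; move: ox; mod3_mod8 x x.
rewrite (@rep_scale 1 2) //; last by move=> x y; mod3_mod8 x y.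
rewrite (@rep_scale 2 3) //; last by move=> x y; mod3_mod8 x y.
rewrite (@rep_split 2 6) //; last by move=> x y; mod3_mod8 x y.
(* Halving 4n = 2x^2 + 6y^2 gives 2n = x^2 + 3y^2, so [odd_reps_parity] applies with M = n. *)
have : odd (rep_odd 2 6 (2 * K) (4 * n)) = odd (sq_odd 2 K n).
  have <- : sq_odd 2 (2 * K) n = sq_odd 2 K n by apply: sq_odd_trunc; lia.
  have [m Km] : exists m, (2 * K = m.+1)%N by exists (8 * n).+1; lia.
  rewrite /sq_odd /rep_odd Km -odd_reps_parity; try lia.
  congr odd; apply: eq_bigr => x _; apply: eq_bigr => y _.
  by congr nat_of_bool; apply/eqP/eqP; lia.
set r := rep_odd _ _ _ _; set s := sq_odd _ _ _ => rs.
(* The defect is 4(r - s), a multiple of 8 because [r] and [s] have equal parity. *)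
exists (h - h' + (r./2)%:R - (s./2)%:R); rewrite natrD.
have half k : k%:R = (odd k)%:R + 2 * (k./2)%:R :> int.
  by rewrite -[in LHS](odd_double_half k) natrD -mul2n natrM.
by rewrite (half r) (half s) rs; ring.
Qed.

Theorem theorem4p1 (n alpha beta : nat) (hbeta : (1 <= beta)%N) :
  [/\ (S3bar (3 * n)%N = S3bar n %[mod 4])%Z,
      (forall j : nat, (j < 3)%N ->
        (S3bar (2 ^ alpha * (3 * n + j))%N = S3bar (3 * n + j)%N %[mod 4])%Z)
    & (forall j : nat, (j < 2)%N ->
        (S3bar (2 ^ (2 * beta + j) * (3 * n + 2))%N =
         S3bar (2 ^ j * (3 * n + 2))%N %[mod 8])%Z)].
Proof.
split; first exact: S3bar_mul3_mod4.
  move=> j _; elim: alpha => [|alpha IH]; first by rewrite mul1n.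
  by rewrite expnS -mulnA S3bar_mul2_mod4.
move=> j lt_j2; elim: beta {hbeta} => [|beta IH]; first by rewrite muln0 add0n.
rewrite mulnS -addnA expnD -mulnA -{}IH.
set m := (2 ^ (2 * beta + j) * _)%N.
have m3 b : (4 ^ b * (3 * n + 2) %% 3)%N = 2%N.
  by rewrite -modnMml -modnXm exp1n mul1n; lia.
have mE : m = (2 ^ j * (4 ^ beta * (3 * n + 2)))%N.
  by rewrite /m expnD expnM mulnAC mulnC.
clearbody m; move: {m3}(m3 beta) => m3; set k := (4 ^ _ * _)%N in m3 mE.
(* As [k] is 2 modulo 3, [m] is 2 modulo 3 for j = 0, and even and 1 modulo 3 for j = 1. *)
case: j lt_j2 mE => [|[|//]] _ ->.
  by apply: S3bar_mul4_mod8_2mod3; rewrite expn0 mul1n.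
by apply: S3bar_mul4_mod8_1mod3; lia.
Qed.
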